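(* Let $\mathcal{E}$ and $\mathcal{I}$ be finite disjoint index sets, let $J:\mathbb{R}^n\to\mathbb{R}$ and $c_i:\mathbb{R}^n\to\mathbb{R}$ ($i\in\mathcal{E}\cup\mathcal{I}$) be functions, and let $\mu_i>0$ for $i\in\mathcal{E}\cup\mathcal{I}$. Let $x^\star$ be a local minimizer of the merit function $$\phi_1(x;\mu)=J(x)+\sum_{i\in\mathcal{E}}\mu_i|c_i(x)|+\sum_{i\in\mathcal{I}}\mu_i[c_i(x)]^-$$ over $\mathbb{R}^n$. If $x^\star$ satisfies $c_i(x^\star)=0$ for all $i\in\mathcal{E}$ and $c_i(x^\star)\ge 0$ for all $i\in\mathcal{I}$, then $x^\star$ is also a local minimizer of the constrained problem $$\min_{x\in\mathbb{R}^n} J(x)\quad\text{subject to}\quad c_i(x)=0\ (i\in\mathcal{E}),\quad c_i(x)\ge 0\ (i\in\mathcal{I}).$$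
   Context: For a real number $a$, $[a]^-:=\max\{0,-a\}$. A local minimizer of the constrained problem is a feasible point $x^\star$ for which there is $r>0$ such that $J(x^\star)\le J(x)$ for all feasible $x$ with $\|x-x^\star\|<r$. A local minimizer of $\phi_1(\cdot;\mu)$ is a point $x^\star$ for which there is $r>0$ such that $\phi_1(x^\star;\mu)\le\phi_1(x;\mu)$ for all $x\in\mathbb{R}^n$ with $\|x-x^\star\|<r$. *)

(* Defs.v *)
From HB Require Import structures.
From mathcomp Require Import all_boot all_order all_algebra.
From mathcomp Require Import classical_sets reals.

Set Implicit Arguments.
Unset Strict Implicit.
Unset Printing Implicit Defensive.

Import Order.TTheory GRing.Theory Num.Theory.

Local Open Scope classical_set_scope.
Local Open Scope ring_scope.

(* The norm that the library puts on 'rV[R]_n is the sup norm, hence this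
   definition of the Euclidean one. *)
Definition enorm (R : realType) (n : nat) (x : 'rV[R]_n) : R :=
  Num.sqrt (\sum_(j < n) x 0 j ^+ 2).

Definition negpart (R : realType) (a : R) : R := Num.max 0 (- a).

(* [A = setT] gives the local minimizers of [f] over the whole space. *)
Definition local_minimizer (R : realType) (n : nat) (A : set 'rV[R]_n)
    (f : 'rV[R]_n -> R) (xs : 'rV[R]_n) : Prop :=
  A xs /\
  exists r : R, 0 < r /\
    forall x : 'rV[R]_n, A x -> enorm (x - xs) < r -> f xs <= f x.

Definition feasible_set (R : realType) (n : nat) (K : finType) (E I : {set K})
    (c : K -> 'rV[R]_n -> R) : set 'rV[R]_n :=
  [set x | (forall i, i \in E -> c i x = 0) /\
           (forall i, i \in I -> 0 <= c i x)].

Definition merit1 (R : realType) (n : nat) (K : finType) (E I : {set K})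
    (J : 'rV[R]_n -> R) (c : K -> 'rV[R]_n -> R) (mu : K -> R)
    (x : 'rV[R]_n) : R :=
  J x + \sum_(i in E) mu i * `|c i x| + \sum_(i in I) mu i * negpart (c i x).

(* Main.v *)
Require Import Defs.
From HB Require Import structures.
From mathcomp Require Import all_boot all_order all_algebra.
From mathcomp Require Import classical_sets reals.

Set Implicit Arguments.
Unset Strict Implicit.
Unset Printing Implicit Defensive.

Import Order.TTheory GRing.Theory Num.Theory.

Local Open Scope ring_scope.

(** The penalty terms of the merit function vanish at every feasible point, so
    there the merit function equals [J] ([merit1_feasible]).  The point [xs] is
    itself feasible; hence, in the ball where [xs] minimizes the merit function,
    comparing [xs] with the feasible points only is comparing values of [J]. *)

Lemma negpart_ge0 (R : realType) (a : R) : 0 <= a -> negpart a = 0.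
Proof. by move=> a_ge0; rewrite /negpart max_l // oppr_le0. Qed.

Lemma merit1_feasible (R : realType) (n : nat) (K : finType) (E I : {set K})
    (J : 'rV[R]_n -> R) (c : K -> 'rV[R]_n -> R) (mu : K -> R) (x : 'rV[R]_n) :
  feasible_set E I c x -> merit1 E I J c mu x = J x.
Proof.
move=> [x_eq x_ineq]; rewrite /merit1 !big1 ?addr0 // => i iP.
  by rewrite negpart_ge0 ?mulr0 //; exact: x_ineq.
by rewrite x_eq // normr0 mulr0.
Qed.

Theorem proposition9 (R : realType) (n : nat) (K : finType) (E I : {set K})
    (EI_disj : [disjoint E & I])
    (J : 'rV[R]_n -> R) (c : K -> 'rV[R]_n -> R) (mu : K -> R)
    (mu_gt0 : forall i, i \in E :|: I -> 0 < mu i)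
    (xs : 'rV[R]_n)
    (xs_min : local_minimizer setT (merit1 E I J c mu) xs)
    (xs_eq : forall i, i \in E -> c i xs = 0)
    (xs_ineq : forall i, i \in I -> 0 <= c i xs) :
  local_minimizer (feasible_set E I c) J xs.
Proof.
have xs_feas : feasible_set E I c xs by split.
case: xs_min => _ [r [r_gt0 r_min]]; split=> //; exists r; split=> // x x_feas xr.
rewrite -(merit1_feasible J mu xs_feas) -(merit1_feasible J mu x_feas).
exact: r_min.
Qed.
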